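(* Let $p$ be an odd prime and let $n$ be a positive integer. Let $G_1$ and $G_2$ be connected graphs such that either $G_1$ or $G_2$ contains a cycle of odd order, where $G_2$ has at least two vertices. Suppose that $G_1$ has order $np$. Let $g_1:V(G_1)\to\{1,2,\ldots,np\}$ be a bijection, and put $$\varrho_1=\{ab\in E(G_1):([g_1(a)+g_1(b)]/p)=1\},$$ $$\eta_1=\{ab\in E(G_1):([g_1(a)+g_1(b)]/p)=-1\text{ or }g_1(a)+g_1(b)\equiv 0\pmod p\}.$$ If $$|\varrho_1|=|\eta_1|,$$ then the tensor product graph $G_1\times G_2$ is a Legendre cordial graph modulo $p$.
   Context: All graphs are finite, simple, and connected. The order of a graph is its number of vertices. ''Either $G_1$ or $G_2$ contains an odd cycle'' is meant inclusively (at least one of them does). Tensor product: $G_1\times G_2$ has vertex set $V(G_1)\times V(G_2)$ and edge set $\{(v_1,u_1)(v_2,u_2): v_1v_2\in E(G_1)\text{ and }u_1u_2\in E(G_2)\}$. Legendre symbol: for an odd prime $p$ and an integer $a$ relatively prime to $p$, $(a/p)=1$ if $x^2\equiv a\pmod p$ has a solution and $(a/p)=-1$ otherwise. Legendre cordial labeling: let $p$ be an odd prime and $H$ a simple connected graph of order $N$. A bijection $f:V(H)\to\{1,2,\ldots,N\}$ is a Legendre cordial labeling modulo $p$ if the induced function $f_p^*:E(H)\to\{0,1\}$, defined by $f_p^*(uv)=0$ if $([f(u)+f(v)]/p)=-1$ or $f(u)+f(v)\equiv 0\pmod p$, and $f_p^*(uv)=1$ if $([f(u)+f(v)]/p)=1$,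 satisfies $|e_{f_p^*}(0)-e_{f_p^*}(1)|\leq 1$, where $e_{f_p^*}(i)$ is the number of edges with label $i$ ($i=0,1$). A graph admitting such a labeling is called a Legendre cordial graph modulo $p$. *)

(* Defs.v *)
From mathcomp Require Import all_boot all_order all_algebra.

Set Implicit Arguments.
Unset Strict Implicit.
Unset Printing Implicit Defensive.

Import Order.TTheory GRing.Theory Num.Theory.
Local Open Scope ring_scope.

Record sgraph := SGraph {
  vertex :> finType;
  adj : rel vertex;
  adj_sym : symmetric adj;
  adj_irr : irreflexive adj
}.

Definition edges (G : sgraph) : {set {set G}} :=
  [set [set x; y] | x in G, y in adj x].

Lemma edgesP (G : sgraph) (e : {set G}) :
  reflect (exists x y : G, adj x y /\ e = [set x; y]) (e \in edges G).
Proof.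
apply: (iffP imset2P) => [[x y _ xy ->] | [x [y [xy ->]]]]; first by exists x, y.
by exists x y.
Qed.

Definition connected (G : sgraph) : Prop :=
  (0 < #|G|)%N /\ forall x y : G, connect (@adj G) x y.

Definition has_odd_cycle (G : sgraph) : Prop :=
  exists c : seq G, [/\ ucycle (@adj G) c, (2 < size c)%N & odd (size c)].

Section Tensor.
Variables G1 G2 : sgraph.

Definition tensor_adj : rel (G1 * G2)%type :=
  fun x y => adj x.1 y.1 && adj x.2 y.2.

Lemma tensor_adj_sym : symmetric tensor_adj.
Proof. by move=> x y; rewrite /tensor_adj adj_sym [adj x.2 _]adj_sym. Qed.

Lemma tensor_adj_irr : irreflexive tensor_adj.
Proof. by move=> x; rewrite /tensor_adj adj_irr. Qed.

Definition tensor : sgraph := SGraph tensor_adj_sym tensor_adj_irr.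
End Tensor.

(* The symbol is only meaningful for a prime to p; it is extended by 0 to
   multiples of p, so that it is then neither 1 nor -1. The search for a square
   root is restricted to residues to make the test decidable, see [legendreP]. *)
Definition legendre (p : nat) (a : int) : int :=
  if (p%:Z %| a)%Z then 0
  else if [exists x : 'I_p, ((x : nat)%:Z ^+ 2 == a %[mod p%:Z])%Z] then 1
  else -1.

Lemma legendreP (p : nat) (a : int) : (1 < p)%N -> coprimez a p%:Z ->
  (legendre p a = 1 <-> exists x : int, (x ^+ 2 = a %[mod p%:Z])%Z) /\
  (legendre p a = -1 <-> ~ exists x : int, (x ^+ 2 = a %[mod p%:Z])%Z).
Proof.
move=> p1 cop; rewrite /legendre.
have -> : (p%:Z %| a)%Z = false.
  apply/negP => pa; move: cop; rewrite coprimez_sym /coprimez.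
  move/gcdz_idPl: pa => ->; rewrite absz_nat.
  by move=> /eqP [p_eq1]; rewrite p_eq1 in p1.
have p0 : p%:Z != 0 by rewrite eqz_nat -lt0n ltnW.
case: existsP => [[x /eqP xa] | nx].
  have ex : exists x : int, (x ^+ 2 = a %[mod p%:Z])%Z by exists (x : nat)%:Z.
  by do !split.
have nex : ~ exists x : int, (x ^+ 2 = a %[mod p%:Z])%Z.
  move=> [x xa]; apply: nx.
  have r0 : 0 <= (x %% p%:Z)%Z by rewrite modz_ge0.
  have rp : (`|(x %% p%:Z)%Z| < p)%N.
    by rewrite -ltz_nat gez0_abs // ltz_pmod // ltz_nat ltnW.
  exists (Ordinal rp) => /=; rewrite gez0_abs // expr2 modzMml modzMmr -expr2.
  by rewrite xa.
by do !split.
Qed.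

Definition bij_onto_interval (T : Type) (f : T -> nat) (N : nat) : Prop :=
  [/\ forall v, (1 <= f v <= N)%N,
      injective f &
      forall k, (1 <= k <= N)%N -> exists v, f v = k].

(* f(u) + f(v) for the edge e = {u, v}. *)
Definition edge_sum (G : sgraph) (f : G -> nat) (e : {set G}) : nat :=
  (\sum_(v in e) f v)%N.

Lemma edge_sumE (G : sgraph) (f : G -> nat) (u v : G) :
  adj u v -> edge_sum f [set u; v] = (f u + f v)%N.
Proof.
move=> uv; rewrite /edge_sum big_setU1 ?big_set1 // inE.
by apply: contraTneq uv => ->; rewrite adj_irr.
Qed.

Definition edge_label (p : nat) (G : sgraph) (f : G -> nat) (e : {set G}) : nat :=
  if (legendre p (edge_sum f e)%:Z == -1) || (edge_sum f e == 0 %[mod p])%N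
  then 0%N else 1%N.

Lemma edge_label1 (p : nat) (G : sgraph) (f : G -> nat) (e : {set G}) :
  (edge_label p f e == 1%N) = (legendre p (edge_sum f e)%:Z == 1).
Proof.
rewrite /edge_label /legendre mod0n dvdzE !absz_nat /dvdn.
by case: (edge_sum f e %% p == 0)%N => //; case: (X in if X then 1 else -1).
Qed.

Definition label_count (p : nat) (G : sgraph) (f : G -> nat) (i : nat) : nat :=
  #|[set e in edges G | edge_label p f e == i]|.

Definition legendre_cordial_labeling (p : nat) (G : sgraph) (f : G -> nat) :
    Prop :=
  bij_onto_interval f #|G| /\
  `|(label_count p f 0)%:Z - (label_count p f 1)%:Z| <= 1.

Definition legendre_cordial (p : nat) (G : sgraph) : Prop :=
  connected G /\ exists f : G -> nat, legendre_cordial_labeling p f.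

(* Main.v *)
Require Import Defs.
From mathcomp Require Import all_boot all_order all_algebra.
Import Order.TTheory GRing.Theory Num.Theory.
Local Open Scope ring_scope.

(** Write [N = n * p] for the order of [G1]. The labeling of [G1 x G2] stacks
    one copy of [g1] per vertex of [G2]: the vertex [(v, u)] gets
    [g1 v + N * r u], where [r] numbers the vertices of [G2] from [0]. By
    Euclidean division by [N] this is a bijection onto [1 .. N * #|G2|], and
    since [p] divides [N] the label of [(v, u)] is congruent to [g1 v]. The
    class (residue or not) of an edge of the product is therefore the class of
    its projection to [G1].

    An edge [ab] of [G1] and an edge [uw] of [G2] span exactly the two edges
    [(a,u)(b,w)] and [(a,w)(b,u)] of the product; hence each class of edges of
    [G1] is multiplied by the same factor [2 * #|E(G2)|], and equal classes in
    [G1] give equal classes in the product ([label_count_tensor]). The count is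
    done on ordered pairs of adjacent vertices (darts): the darts of the product
    are the pairs of a dart of [G1] and a dart of [G2], and every edge carries
    two of them ([card_labelled_darts]).

    Connectedness of the product ([connected_tensor], due to Weichsel) comes
    from the fact that a walk in the product is a pair of walks of the same
    length. Going back and forth along an edge lengthens a walk by 2, so only
    the parities of the two lengths have to agree, and a detour through an odd
    cycle changes the parity in the factor that contains one. *)

(** * Walks and connectedness of the tensor product *)

Definition walk (G : sgraph) (k : nat) (x y : G) : Prop :=
  exists s, [/\ path (@adj G) x s, last x s = y & size s = k].

Lemma walk_cat (G : sgraph) (k l : nat) (x y z : G) :
  walk G k x y -> walk G l y z -> walk G (k + l) x z.
Proof.
move=> [s [xs <- <-]] [t [yt <- <-]]; exists (s ++ t).
by rewrite cat_path xs yt last_cat size_cat.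
Qed.

Lemma walk_sym (G : sgraph) (k : nat) (x y : G) :
  walk G k x y -> walk G k y x.
Proof.
move=> [s [xs <- <-]]; exists (rev (belast x s)); split.
- by rewrite rev_path (@eq_path _ _ (@adj G)) // => a b; apply: adj_sym.
- by case: s {xs} => [|a s] //=; rewrite rev_cons last_rcons.
- by rewrite size_rev size_belast.
Qed.

Lemma walk_connect (G : sgraph) (x y : G) :
  connect (@adj G) x y <-> exists k, walk G k x y.
Proof.
split=> [/connectP [s xs ->] | [k [s [xs <- _]]]]; first by exists (size s), s.
by apply/connectP; exists s.
Qed.

Lemma connected_has_neighbour (G : sgraph) (x : G) :
  connected G -> (1 < #|G|)%N -> exists y, adj x y.
Proof.
move=> [_ cG] G2.
have /card_gt0P [y] : (0 < #|predC1 x|)%N.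
  by rewrite cardC1 -subn1 subn_gt0.
rewrite !inE => yx; have /connectP [[|z s] /= xs yE] := cG x y.
  by case/eqP: yx.
by exists z; case/andP: xs.
Qed.

(** Each step back and forth along an edge at [x] adds 2 to the length. *)
Lemma walk_pad (G : sgraph) (k m : nat) (x y : G) :
  connected G -> (1 < #|G|)%N -> walk G k x y -> walk G (k + m.*2) x y.
Proof.
move=> cG G2; elim: m => [|m IHm] wk; first by rewrite double0 addn0.
have [z xz] := connected_has_neighbour G x cG G2.
rewrite doubleS !addnS -add2n; apply: (@walk_cat G 2 _ x x y) (IHm wk).
by exists [:: z; x]; rewrite /= xz adj_sym xz.
Qed.

Lemma odd_closed_walk (G : sgraph) :
  has_odd_cycle G -> exists (c : G) (k : nat), odd k /\ walk G k c c.
Proof.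
move=> [[|c s] [/andP [cs _] s2 so]] //; exists c, (size s).+1; split=> //.
by exists (rcons s c); rewrite last_rcons size_rcons.
Qed.

(** If some walk from [x] to [y] has the wrong parity, precede it by the closed
    walk that goes from [x] to the odd cycle, around it, and back. *)
Lemma walk_of_parity (G : sgraph) (x y : G) (b : bool) :
  connected G -> has_odd_cycle G -> exists k, odd k = b /\ walk G k x y.
Proof.
move=> [_ cG] /odd_closed_walk [c [m [mo cc]]].
have [k xy] := (walk_connect G x y).1 (cG x y).
have [l xc] := (walk_connect G x c).1 (cG x c).
have [kb|kb] := eqVneq (odd k) b; first by exists k.
exists (l + m + l + k)%N; split.
  by rewrite !oddD mo; case: (odd l) (odd k) b kb => [] [] [].
apply: walk_cat xy; apply: walk_cat (walk_sym G l x c xc).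
exact: walk_cat xc cc.
Qed.

Lemma walk_tensor (G1 G2 : sgraph) (k : nat) (x1 y1 : G1) (x2 y2 : G2) :
  walk G1 k x1 y1 -> walk G2 k x2 y2 ->
  walk (tensor G1 G2) k (x1, x2) (y1, y2).
Proof.
move=> [s [xs <- <-]] [t [xt <- st]]; exists (zip s t).
elim: s t x1 x2 xs xt st => [|a s IHs] [|b t] x1 x2 //=.
move=> /andP [xa as_] /andP [xb bt] [st].
have [-> lst ->] := IHs t a b as_ bt st.
by rewrite lst /tensor_adj /= xa xb.
Qed.

(** Any common length of the right parity that exceeds both [k] and [l] would
    do: [k + l + l] is [k] plus an even number, and [l] plus [k + l]. *)
Lemma walk_tensor_parity (G1 G2 : sgraph) (k l : nat)
    (x1 y1 : G1) (x2 y2 : G2) :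
  connected G1 -> connected G2 -> (1 < #|G1|)%N -> (1 < #|G2|)%N ->
  odd k = odd l -> walk G1 k x1 y1 -> walk G2 l x2 y2 ->
  walk (tensor G1 G2) (k + l + l) (x1, x2) (y1, y2).
Proof.
move=> c1 c2 n1 n2 kl w1 w2; apply: walk_tensor.
  by rewrite -addnA addnn; apply: walk_pad.
have -> : (k + l + l = l + (k + l)./2.*2)%N.
  by rewrite halfK oddD kl addbb subn0 addnC.
exact: walk_pad.
Qed.

(** Weichsel's theorem: take any walk in one factor, and match its parity by a
    walk in the factor that contains an odd cycle. *)
Lemma connected_tensor (G1 G2 : sgraph) :
  connected G1 -> connected G2 -> (1 < #|G1|)%N -> (1 < #|G2|)%N ->
  has_odd_cycle G1 \/ has_odd_cycle G2 -> connected (tensor G1 G2).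
Proof.
move=> c1 c2 n1 n2 odd12; split; first by rewrite card_prod muln_gt0 c1.1 c2.1.
move=> [x1 x2] [y1 y2]; apply/walk_connect.
have [k [l [kl w1 w2]]] :
    exists k l, [/\ odd k = odd l, walk G1 k x1 y1 & walk G2 l x2 y2].
  case: odd12 => oc.
    have [l w2] := (walk_connect G2 x2 y2).1 (c2.2 x2 y2).
    by have [k [kl w1]] := walk_of_parity G1 x1 y1 (odd l) c1 oc; exists k, l.
  have [k w1] := (walk_connect G1 x1 y1).1 (c1.2 x1 y1).
  by have [l [kl w2]] := walk_of_parity G2 x2 y2 (odd k) c2 oc; exists k, l.
by exists (k + l + l)%N; apply: walk_tensor_parity.
Qed.

(** * Counting labelled edges *)

Definition darts (G : sgraph) : {set G * G} := [set d | adj d.1 d.2].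

(** The fibre of [d |-> {d.1, d.2}] over an edge [{x, y}] is the pair of darts
    [(x, y)] and [(y, x)], distinct because there are no loops. *)
Lemma card_labelled_darts (G : sgraph) (P : pred {set G}) :
  #|[set d in darts G | P [set d.1; d.2]]| = (#|[set e in edges G | P e]| * 2)%N.
Proof.
rewrite -sum1_card (partition_big (fun d : G * G => [set d.1; d.2])
  (mem [set e in edges G | P e])) /=; last first.
  move=> d; rewrite !inE => /andP [dd ->]; rewrite andbT.
  by apply/edgesP; exists d.1, d.2.
rewrite -sum_nat_const; apply: eq_bigr => e; rewrite inE => /andP [].
move=> /edgesP [x [y [xy ->]]] Pxy.
have nxy : x != y by apply: contraTneq xy => ->; rewrite adj_irr.
have -> : 2%N = #|[set (x, y); (y, x)]|.
  by rewrite cards2 xpair_eqE (negbTE nxy).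
rewrite sum1dep_card; apply: eq_card => -[a b]; rewrite !inE /= !xpair_eqE.
apply/idP/idP => [/andP [/andP [ab _] /eqP abE] | ].
  have : a \in [set x; y] by rewrite -abE !inE eqxx.
  have : b \in [set x; y] by rewrite -abE !inE eqxx orbT.
  rewrite !inE => /orP [] /eqP bE /orP [] /eqP aE; move: ab;
    by rewrite aE bE ?adj_irr ?eqxx ?orbT.
case/orP => /andP [/eqP -> /eqP ->]; first by rewrite xy Pxy eqxx.
by rewrite adj_sym xy setUC Pxy eqxx.
Qed.

Lemma legendre_congr (p s t : nat) :
  (s = t %[mod p])%N -> legendre p s%:Z = legendre p t%:Z.
Proof. by move=> st; rewrite /legendre !dvdzE !absz_nat /dvdn !modz_nat st. Qed.

(** A label only depends on the sum of its edge modulo [p], so the copies of an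
    edge of [G1] keep its label. *)
Lemma edge_label_tensor (p : nat) (G1 G2 : sgraph) (g : G1 -> nat)
    (f : tensor G1 G2 -> nat) (x y : tensor G1 G2) :
  (forall z, f z = g z.1 %[mod p])%N -> adj x y ->
  edge_label p f [set x; y] = edge_label p g [set x.1; y.1].
Proof.
move=> fg xy; have /andP [xy1 _] := xy.
have st : (f x + f y = g x.1 + g y.1 %[mod p])%N by rewrite -modnDm !fg modnDm.
by rewrite /edge_label !edge_sumE // (legendre_congr _ _ _ st) st.
Qed.

(** Interchanging the middle coordinates identifies the darts of the product
    with the pairs of a dart of [G1] and a dart of [G2], and only the former
    matters for the label. *)
Lemma label_count_tensor (p : nat) (G1 G2 : sgraph) (g : G1 -> nat)
    (f : tensor G1 G2 -> nat) (i : nat) :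
  (forall z, f z = g z.1 %[mod p])%N ->
  label_count p f i = (label_count p g i * #|darts G2|)%N.
Proof.
move=> fg; apply/eqP; rewrite -(eqn_pmul2r (isT : 0 < 2)%N) mulnAC; apply/eqP.
rewrite /label_count -(card_labelled_darts _ (fun e => edge_label p f e == i)).
rewrite -(card_labelled_darts _ (fun e => edge_label p g e == i)) -cardsX.
pose h (d : (G1 * G2) * (G1 * G2)) := ((d.1.1, d.2.1), (d.1.2, d.2.2)).
pose h' (d : (G1 * G1) * (G2 * G2)) := ((d.1.1, d.2.1), (d.1.2, d.2.2)).
have hK : cancel h h' by move=> [[? ?] [? ?]].
have h'K : cancel h' h by move=> [[? ?] [? ?]].
rewrite -(card_imset _ (can_inj hK)); apply: eq_card => d.
rewrite (can2_imset_pre _ hK h'K); case: d => [[a b] [u w]]; rewrite !inE /=.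
have [xy|] := boolP (@tensor_adj G1 G2 (a, u) (b, w)).
  rewrite (edge_label_tensor p G1 G2 g f (a, u) (b, w)) //=.
  by case/andP: xy => /= -> ->; rewrite andbT.
by rewrite /tensor_adj /= negb_and => /orP [] /negbTE ->; rewrite ?andbF.
Qed.

(** * The stacked labeling *)

Definition stack {T : Type} {U : finType} (N : nat) (g : T -> nat)
    (z : T * U) : nat := (g z.1 + N * enum_rank z.2)%N.

(** [(g v).-1] and [enum_rank u] are the remainder and the quotient of the
    Euclidean division of [(stack N g (v, u)).-1] by [N]. *)
Lemma stack_bij (T : Type) (U : finType) (N : nat) (g : T -> nat) :
  bij_onto_interval g N ->
  bij_onto_interval (@stack T U N g) (N * #|U|).
Proof.
move=> [gN ginj gsurj]; split.
- move=> [v u]; rewrite /stack /=; have /andP [g1 gle] := gN v.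
  rewrite ltn_addr //=.
  apply: (@leq_trans (N * (enum_rank u).+1)); first by rewrite mulnS leq_add2r.
  by rewrite leq_mul2l ltn_ord orbT.
- move=> [v u] [v' u']; rewrite /stack /= => E.
  have /andP [g1 gle] := gN v; have /andP [g1' gle'] := gN v'.
  have N0 : (0 < N)%N by apply: leq_trans gle.
  have {}E : (enum_rank u * N + (g v).-1 = enum_rank u' * N + (g v').-1)%N.
    apply: succn_inj; rewrite -!addnS !prednK //.
    by rewrite ![(_ * N)%N]mulnC addnC E addnC.
  have lt w : (0 < g w <= N)%N -> ((g w).-1 < N)%N by case: (g w).
  have Eq := congr1 (divn^~ N) E; have Er := congr1 (modn^~ N) E.
  rewrite !divnMDl // !divn_small ?addn0 ?lt ?g1 ?g1' // in Eq.
  rewrite !modnMDl !modn_small ?lt ?g1 ?g1' // in Er.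
  have -> : u = u' by apply/enum_rank_inj/val_inj.
  have -> : v = v' by apply: ginj; rewrite -(prednK g1) -(prednK g1') Er.
  by [].
- move=> [|k] // /= kle.
  have N0 : (0 < N)%N by case: (N) kle.
  have qU : (k %/ N < #|U|)%N by rewrite ltn_divLR // mulnC.
  have [v gv] : exists v, g v = (k %% N).+1 by apply: gsurj; rewrite ltn_pmod.
  exists (v, enum_val (Ordinal qU)).
  by rewrite /stack /= gv enum_valK /= addSn addnC mulnC -divn_eq.
Qed.

Theorem theorem3p7 (p n : nat) (hp : prime p) (hodd : odd p) (hn : (0 < n)%N)
    (G1 G2 : sgraph) (hG1 : connected G1) (hG2 : connected G2)
    (hcycle : has_odd_cycle G1 \/ has_odd_cycle G2)
    (hG2card : (2 <= #|G2|)%N) (hG1card : #|G1| = (n * p)%N)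
    (g1 : G1 -> nat) (hg1 : bij_onto_interval g1 (n * p))
    (hbal :
      #|[set e in edges G1 | legendre p (edge_sum g1 e)%:Z == 1]| =
      #|[set e in edges G1 | (legendre p (edge_sum g1 e)%:Z == -1)
                             || (edge_sum g1 e == 0 %[mod p])%N]|) :
  legendre_cordial p (tensor G1 G2).
Proof.
have n1 : (1 < #|G1|)%N.
  by rewrite hG1card (leq_trans (prime_gt1 hp)) // leq_pmull.
split; first exact: connected_tensor.
exists (stack (n * p) g1); split.
  by rewrite card_prod hG1card; apply: stack_bij.
have fg (z : tensor G1 G2) : (stack (n * p) g1 z = g1 z.1 %[mod p])%N.
  by rewrite /stack mulnAC addnC modnMDl.
have bal : label_count p g1 0 = label_count p g1 1.
  rewrite /label_count; transitivity
    #|[set e in edges G1 | (legendre p (edge_sum g1 e)%:Z == -1)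
                           || (edge_sum g1 e == 0 %[mod p])%N]|.
    by apply: eq_card => e; rewrite !inE /edge_label; case: (_ || _).
  by rewrite -hbal; apply: eq_card => e; rewrite !inE edge_label1.
by rewrite !(label_count_tensor p G1 G2 g1) // bal subrr normr0.
Qed.
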